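(* The Binary Algorithm given in the context (for solving Problem QRAP-NonSep-GBC using binary breakpoint search) has a time complexity of $O(n\log n)$.
   Context: **Problem.** Let $\mathcal N=\{1,\dots,n\}$ be partitioned into disjoint subsets $\mathcal N_1,\dots,\mathcal N_m$ of sizes $n_1,\dots,n_m$, and let $\mathcal M=\{1,\dots,m\}$. Given $w,L,U\in\mathbb R^m$, $a\in\mathbb R^n_{>0}$, $b,l,u\in\mathbb R^n$, $R\in\mathbb R$, Problem QRAP-NonSep-GBC is $$\min_{x\in\mathbb R^n}\ \sum_{j=1}^m\tfrac12 w_j\Big(\sum_{i\in\mathcal N_j}x_i\Big)^2+\sum_{i=1}^n\big(\tfrac12a_ix_i^2+b_ix_i\big)$$ subject to $\sum_{i=1}^n x_i=R$; $L_j\le\sum_{i\in\mathcal N_j}x_i\le U_j$ for $j\in\mathcal M$; $l_i\le x_i\le u_i$ for $i\in\mathcal N$. Only instances with $1+w_j\sum_{i\in\mathcal N_j}1/a_i>0$ for every $j\in\mathcal M$ are considered (equivalently, strictly convex instances), and they are assumed feasible (Slater's condition). For $j\in\mathcal M$ and $S\in\mathbb R$, $\mathrm{QRAP}^j(S)$ is the problem of minimizing $\sum_{i\in\mathcal N_j}(\frac12a_ix_i^2+b_ix_i)$ subject to $\sum_{i\in\mathcal N_j}x_i=S$ and $l_i\le x_i\le u_i$ ($i\in\mathcal N_j$). Let $(\underline x_i)_{i\in\mathcal N_j}$ and $(\bar x_i)_{i\in\mathcal N_j}$ denote optimal solutions of $\mathrm{QRAP}^j(L_j)$ and $\mathrm{QRAP}^j(U_j)$;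 these subproblems are solved by a linear-time algorithm for simple quadratic resource allocation. After the replacement of bounds in Line 2 below, the constraints $L_j\le\sum_{i\in\mathcal N_j}x_i\le U_j$ are dropped, and $l,u$ denote the new bounds. **Notation.** For $\lambda\in\mathbb R$, $(x(\lambda),\mu(\lambda))$ is the solution of: $w_jy_j+a_ix_i+b_i+\lambda+\mu_i=0$ ($j\in\mathcal M$, $i\in\mathcal N_j$), $l_i\le x_i\le u_i$, $\max(0,\mu_i)(x_i-u_i)=0$, $\min(0,\mu_i)(x_i-l_i)=0$, where $y_j=\sum_{i\in\mathcal N_j}x_i$; $y_j(\lambda)=\sum_{i\in\mathcal N_j}x_i(\lambda)$. An optimal multiplier $\lambda^*$ is one with $\sum_ix_i(\lambda^* )=R$; then $x(\lambda^* )$ is the optimal solution. It is taken that for each $i$ there are unique breakpoints $\alpha_i<\beta_i$ with $\lambda\le\alpha_i\Leftrightarrow x_i(\lambda)=u_i$; $\alpha_i<\lambda<\beta_i\Leftrightarrow l_i<x_i(\lambda)<u_i$; $\beta_i\le\lambda\Leftrightarrow x_i(\lambda)=l_i$. Put $\mathcal N_j^{\rm lower}(\lambda)=\{i\in\mathcal N_j:\beta_i\le\lambda\}$, $\mathcal N_j^{\rm upper}(\lambda)=\{i\in\mathcal N_j:\alpha_i\ge\lambda\}$, $\mathcal N_j^{\rm free}(\lambda)=\{i\in\mathcal N_j:\alpha_i<\lambda<\beta_i\}$, and $$y_j^{\rm fixed}(\lambda)=\sum_{i\in\mathcal N_j^{\rm lower}(\lambda)}l_i+\sum_{i\in\mathcal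 N_j^{\rm upper}(\lambda)}u_i,\quad A_j(\lambda)=\sum_{i\in\mathcal N_j^{\rm free}(\lambda)}\frac1{a_i},\quad B_j(\lambda)=\sum_{i\in\mathcal N_j^{\rm free}(\lambda)}\frac{b_i}{a_i}.$$ The algorithm uses the formula (F1) $$y_j(\lambda)=\frac{y_j^{\rm fixed}(\lambda)-B_j(\lambda)}{1+w_jA_j(\lambda)}-\frac{A_j(\lambda)}{1+w_jA_j(\lambda)}\lambda .$$ ''Compute $x(\lambda)$'' means: $x_i(\lambda)=l_i$ on $\mathcal N_j^{\rm lower}(\lambda)$, $x_i(\lambda)=u_i$ on $\mathcal N_j^{\rm upper}(\lambda)$, and for $i\in\mathcal N_j^{\rm free}(\lambda)$ $$x_i(\lambda)=\frac1{a_i}\,\frac{-w_jy_j^{\rm fixed}(\lambda)-\lambda}{1+w_jA_j(\lambda)}-\frac{b_i}{a_i}+\frac{w_j}{a_i}\,\frac{B_j(\lambda)}{1+w_jA_j(\lambda)}.$$ **Breakpoint Procedure (for a given $j\in\mathcal M$).** 1. Compute the sets $\mathcal P_j=\{a_il_i+b_i: i\in\mathcal N_j\}$ and $\mathcal Q_j=\{a_iu_i+b_i: i\in\mathcal N_j\}$ (maintained as sorted lists). 2. Initialize $\bar Y:=\sum_{i\in\mathcal N_j}u_i$; $\bar A:=0$; $\bar B:=0$. 3. Repeat: 4. Take the smallest value $\eta_k:=\min(\mathcal P_j\cup\mathcal Q_j)$, $k$ being its index. 5. If $\eta_k\in\mathcal Q_j$ (breakpoint of type $\alpha_k$): 6.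 $y_j^{\rm fixed}(\alpha_k)=\bar Y$; $A_j(\alpha_k)=\bar A$; $B_j(\alpha_k)=\bar B$; 7. $\alpha_k:=w_j(B_j(\alpha_k)-y_j^{\rm fixed}(\alpha_k))-(a_ku_k+b_k)(1+w_jA_j(\alpha_k))$; 8. $\bar Y=\bar Y-u_k$; $\bar A=\bar A+1/a_k$; $\bar B=\bar B+b_k/a_k$; 9. $\mathcal Q_j=\mathcal Q_j\setminus\{\eta_k\}$. 10. Else (breakpoint of type $\beta_k$): 11. $y_j^{\rm fixed}(\beta_k)=\bar Y$; $A_j(\beta_k)=\bar A$; $B_j(\beta_k)=\bar B$; 12. $\beta_k:=w_j(B_j(\beta_k)-y_j^{\rm fixed}(\beta_k))-(a_kl_k+b_k)(1+w_jA_j(\beta_k))$; 13. $\bar Y=\bar Y+l_k$; $\bar A=\bar A-1/a_k$; $\bar B=\bar B-b_k/a_k$; 14. $\mathcal P_j=\mathcal P_j\setminus\{\eta_k\}$. 15. End if. 16. Until $\mathcal P_j\cup\mathcal Q_j=\emptyset$. **Binary Algorithm.** (Medians of unsorted sets are computed by a linear-time median algorithm.) 1. For $j\in\mathcal M$: 2. Solve $\mathrm{QRAP}^j(L_j)$ and $\mathrm{QRAP}^j(U_j)$ and set $l_i:=\max(l_i,\underline x_i)$, $u_i:=\min(u_i,\bar x_i)$ for $i\in\mathcal N_j$. 3. Compute $\alpha_i,\beta_i$ for each $i\in\mathcal N_j$ using the Breakpoint Procedure. 4. End for. 5. $\mathcal B:=\{\alpha_i: i\in\mathcal N\}\cup\{\beta_i: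 i\in\mathcal N\}$; $\mathcal B^0:=\mathcal B$; $\tau:=0$. 6. For $j\in\mathcal M$: $\mathcal I_j^0:=\mathcal N_j$, $Y_j^0=\bar A_j^0=\bar B_j^0=0$. 7. $\lambda_\downarrow^0=-\infty$; $\lambda_\uparrow^0=\infty$. 8. While $|\mathcal B^\tau|>1$: 9. $\hat\gamma^\tau:=\mathrm{median}(\mathcal B^\tau)$. 10. For $j\in\mathcal M$: 11. $y_j^{\rm fixed}(\hat\gamma^\tau):=Y_j^\tau$; $A_j(\hat\gamma^\tau):=\bar A_j^\tau$; $B_j(\hat\gamma^\tau):=\bar B_j^\tau$. 12. For $k\in\mathcal I_j^\tau$: 13–14. If $k\in\mathcal N_j^{\rm lower}(\hat\gamma^\tau)$: add $l_k$ to $y_j^{\rm fixed}(\hat\gamma^\tau)$. 15–16. Else if $k\in\mathcal N_j^{\rm upper}(\hat\gamma^\tau)$: add $u_k$ to $y_j^{\rm fixed}(\hat\gamma^\tau)$. 17–19. Else: add $1/a_k$ to $A_j(\hat\gamma^\tau)$ and $b_k/a_k$ to $B_j(\hat\gamma^\tau)$. 20–21. End for ($k$); end for ($j$). 22. Compute $\sum_{j=1}^my_j(\hat\gamma^\tau)$ using (F1). 23–25. If $\sum_jy_j(\hat\gamma^\tau)=R$: $\lambda^*=\hat\gamma^\tau$; compute $x(\lambda^* )$ as $x(\hat\gamma^\tau)$; return. 26–28. Else if $\sum_{i=1}^nx_i(\hat\gamma^\tau)<R$ (i.e. $\sum_jy_j(\hat\gamma^\tau)<R$): $\mathcal B^{\tau+1}:=\{\lambda\in\mathcal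 B^\tau:\lambda<\hat\gamma^\tau\}$; $\lambda_\downarrow^{\tau+1}:=\lambda_\downarrow^\tau$; $\lambda_\uparrow^{\tau+1}:=\hat\gamma^\tau$. 29–32. Else: $\mathcal B^{\tau+1}:=\{\lambda\in\mathcal B^\tau:\lambda\ge\hat\gamma^\tau\}$; $\lambda_\downarrow^{\tau+1}:=\hat\gamma^\tau$; $\lambda_\uparrow^{\tau+1}:=\lambda_\uparrow^\tau$. 33. For $j\in\mathcal M$: 34. $\mathcal I_j^{\tau+1}:=\mathcal I_j^\tau$; $Y_j^{\tau+1}:=Y_j^\tau$; $\bar A_j^{\tau+1}:=\bar A_j^\tau$; $\bar B_j^{\tau+1}:=\bar B_j^\tau$. 35. For $k\in\mathcal I_j^\tau$: 36–37. If $\beta_k\le\lambda_\downarrow^{\tau+1}$: remove $k$ from $\mathcal I_j^{\tau+1}$; $Y_j^{\tau+1}=Y_j^{\tau+1}+l_k$. 38–39. Else if $\alpha_k\le\lambda_\downarrow^{\tau+1}\le\lambda_\uparrow^{\tau+1}\le\beta_k$: remove $k$ from $\mathcal I_j^{\tau+1}$; $\bar A_j^{\tau+1}=\bar A_j^{\tau+1}+1/a_k$; $\bar B_j^{\tau+1}=\bar B_j^{\tau+1}+b_k/a_k$. 40–42. Else if $\lambda_\uparrow^{\tau+1}\le\alpha_k$: remove $k$ from $\mathcal I_j^{\tau+1}$; $Y_j^{\tau+1}=Y_j^{\tau+1}+u_k$. 43–44. End for ($k$); end for ($j$). 45. $\tau=\tau+1$. 46. End while. 47. Determine $\gamma$ as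 the single element of $\mathcal B^\tau$. 48. Compute $\lambda^*=\Big(\sum_{j=1}^m\frac{y_j^{\rm fixed}(\gamma)-B_j(\gamma)}{1+w_jA_j(\gamma)}-R\Big)\Big/\sum_{j=1}^m\frac{A_j(\gamma)}{1+w_jA_j(\gamma)}$ and compute $x(\lambda^* )$. 49. Return. *)

(* Defs.v *)
From HB Require Import structures.
From mathcomp Require Import all_boot all_order all_algebra.
From mathcomp Require Import all_classical all_reals all_analysis.

Set Implicit Arguments.
Unset Strict Implicit.
Unset Printing Implicit Defensive.

Import Order.TTheory GRing.Theory Num.Theory numFieldNormedType.Exports.

Local Open Scope ring_scope.

(* ------------------------------------------------------------------------ *)
(* Cost model: uniform-cost real RAM.  One unit is charged for each         *)
(* arithmetic operation, comparison and assignment (with its operands       *)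
(* fetched from memory), for each array write, for each list cell created   *)
(* or inspected, and for each test of a loop.  Reserving memory for arrays, *)
(* without initialising them, is free.                                      *)
(*   A program is the relation: it terminates with result r after exactly   *)
(* t units.  A diverging program is the empty relation.                     *)
(* ------------------------------------------------------------------------ *)

Definition prog (A : Type) := A -> nat -> Prop.

Definition ret (A : Type) (a : A) : prog A := fun r t => r = a /\ t = 0%N.

Definition op (A : Type) (a : A) : prog A := fun r t => r = a /\ t = 1%N.

Definition tick : prog unit := op tt.

Definition bind (A B : Type) (p : prog A) (f : A -> prog B) : prog B :=
  fun r t => exists a t1 t2, [/\ p a t1, f a r t2 & t = (t1 + t2)%N].

(* A subroutine is represented by its result and the time it takes. *)
Definition call (A : Type) (c : A * nat) : prog A :=
  fun r t => r = c.1 /\ t = c.2.+1.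

(* [step s] either yields a new state [inl s'] or exits with [inr a]. *)
Inductive loop (S A : Type) (step : S -> prog (S + A)) : S -> A -> nat -> Prop :=
| loop_exit s a t : step s (inr a) t -> loop step s a t
| loop_next s s' a t1 t2 :
    step s (inl s') t1 -> loop step s' a t2 -> loop step s a (t1 + t2)%N.

Definition runs_within (A : Type) (p : prog A) (b : nat) : Prop :=
  (exists r t, p r t) /\ (forall r t, p r t -> (t <= b)%N).

Declare Scope prog_scope.
Delimit Scope prog_scope with prog.

Notation "'let*' x ':=' p 'in' q" := (bind p (fun x => q))
  (at level 200, x name, p at level 100, q at level 200,
   format "'[v' 'let*'  x  ':='  p  'in' '/' q ']'") : prog_scope.
Notation "'let*' ' x ':=' p 'in' q" := (bind p (fun x => let: x := x in q))
  (at level 200, x strict pattern, p at level 100, q at level 200,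
   only parsing) : prog_scope.

Local Open Scope prog_scope.

Fixpoint foreach (A S : Type) (s : seq A) (st : S) (body : A -> S -> prog S)
    {struct s} : prog S :=
  if s is x :: s' then
    let* _ := tick in
    let* st' := body x st in
    foreach s' st' body
  else let* _ := tick in ret st.

Inductive expr (R : Type) : Type :=
| Val of R
| Opp of expr R
| Add of expr R & expr R
| Sub of expr R & expr R
| Mul of expr R & expr R
| Div of expr R & expr R
| Max of expr R & expr R
| Min of expr R & expr R.

Fixpoint value (R : realType) (e : expr R) : R :=
  match e with
  | Val x => x
  | Opp e1 => - value e1
  | Add e1 e2 => value e1 + value e2
  | Sub e1 e2 => value e1 - value e2
  | Mul e1 e2 => value e1 * value e2
  | Div e1 e2 => value e1 / value e2
  | Max e1 e2 => Num.max (value e1) (value e2)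
  | Min e1 e2 => Num.min (value e1) (value e2)
  end.

Fixpoint operations (R : Type) (e : expr R) : nat :=
  match e with
  | Val _ => 0
  | Opp e1 => (operations e1).+1
  | Add e1 e2 | Sub e1 e2 | Mul e1 e2 | Div e1 e2 | Max e1 e2 | Min e1 e2 =>
      (operations e1 + operations e2).+1
  end.

(* One unit per operator of [e], plus one for storing the result. *)
Definition compute (R : realType) (e : expr R) : prog R :=
  fun r t => r = value e /\ t = (operations e).+1.

Declare Scope expr_scope.
Delimit Scope expr_scope with expr.
Bind Scope expr_scope with expr.
Arguments compute {R} e%_expr.
Notation "$ x" := (Val x) (at level 0, x at level 0, format "$ x") : expr_scope.
Notation "- e" := (Opp e) : expr_scope.
Notation "e1 + e2" := (Add e1 e2) : expr_scope.
Notation "e1 - e2" := (Sub e1 e2) : expr_scope.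
Notation "e1 * e2" := (Mul e1 e2) : expr_scope.
Notation "e1 / e2" := (Div e1 e2) : expr_scope.

Definition upd (I : eqType) (A : Type) (f : I -> A) (i : I) (a : A) : I -> A :=
  fun k => if k == i then a else f k.

Definition write (I : eqType) (A : Type) (f : I -> A) (i : I) (a : A) :
    prog (I -> A) :=
  op (upd f i a).

(* ------------------------------------------------------------------------ *)
(* Bottom-up merge sort                                                     *)
(* ------------------------------------------------------------------------ *)

Fixpoint merge_lists (A : Type) (le : rel A) (s1 : seq A) : seq A -> prog (seq A) :=
  if s1 is x1 :: s1' then
    fix merge_s1 (s2 : seq A) : prog (seq A) :=
      let* _ := tick in
      if s2 is x2 :: s2' then
        let* c := op (le x1 x2) in
        if c then let* s := merge_lists le s1' s2 in op (x1 :: s)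
        else let* s := merge_s1 s2' in op (x2 :: s)
      else ret s1
  else fun s2 => let* _ := tick in ret s2.

Fixpoint merge_pairs (A : Type) (le : rel A) (ss : seq (seq A)) :
    prog (seq (seq A)) :=
  if ss is s1 :: s2 :: ss' then
    let* _ := tick in
    let* s := merge_lists le s1 s2 in
    let* r := merge_pairs le ss' in
    op (s :: r)
  else let* _ := tick in ret ss.

Definition merge_sort (A : Type) (le : rel A) (s : seq A) : prog (seq A) :=
  let* ss := foreach s [::] (fun x ss => op ([:: x] :: ss)) in
  loop (fun ss =>
          let* _ := tick in
          match ss with
          | [::] => ret (inr [::])
          | [:: s'] => ret (inr s')
          | _ => let* ss' := merge_pairs le ss in ret (inl ss')
          end)
       ss.

(* A finite set of reals is stored as a duplicate-free list. *)
Definition make_set (R : realType) (s : seq R) : prog (seq R) :=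
  let* t := merge_sort (fun x y => x <= y) s in
  foreach t [::] (fun x acc =>
    let* dup := op (if acc is y :: _ then x == y else false) in
    if dup then ret acc else op (x :: acc)).

(* ------------------------------------------------------------------------ *)
(* Problem instances                                                        *)
(*   min \sum_j w_j / 2 * (\sum_(i in N_j) x_i)^2                           *)
(*       + \sum_i (a_i / 2 * x_i^2 + b_i * x_i)                             *)
(*   s.t. \sum_i x_i = R,  L_j <= \sum_(i in N_j) x_i <= U_j,               *)
(*        l_i <= x_i <= u_i                                                 *)
(* The partition is given by [blk]: i belongs to N_(blk i).                 *)
(* ------------------------------------------------------------------------ *)

Record instance (R : realType) (n m : nat) := Instance {
  blk : 'I_n -> 'I_m;
  wgt : 'I_m -> R;
  Lbd : 'I_m -> R;
  Ubd : 'I_m -> R;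
  acoef : 'I_n -> R;
  bcoef : 'I_n -> R;
  lbd : 'I_n -> R;
  ubd : 'I_n -> R;
  total : R
}.

(* The list of the elements of N_j; it is part of the input. *)
Definition block (R : realType) (n m : nat) (P : instance R n m) (j : 'I_m) :
    seq 'I_n :=
  enum [set i | blk P i == j].

Definition feasible (R : realType) (n m : nat) (P : instance R n m)
    (x : 'I_n -> R) : Prop :=
  [/\ \sum_i x i = total P,
      forall j, Lbd P j <= \sum_(i | blk P i == j) x i <= Ubd P j
    & forall i, lbd P i <= x i <= ubd P i].

Definition admissible (R : realType) (n m : nat) (P : instance R n m) : Prop :=
  [/\ forall j, exists i, blk P i = j,
      forall i, 0 < acoef P i,
      forall j, 0 < 1 + wgt P j * \sum_(i | blk P i == j) (acoef P i)^-1
    & exists x, feasible P x].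

(* ------------------------------------------------------------------------ *)
(* The two linear-time subroutines                                          *)
(* ------------------------------------------------------------------------ *)

(* A median of [s] has at most half of [s] on either side.  When [s] has an *)
(* even number of elements this leaves a choice; the only choice excluded   *)
(* is the least element of [s], i.e. the lower of two elements, for which   *)
(* {lambda in s | lambda >= median} would be all of [s] and the search      *)
(* would not progress.                                                      *)
Definition is_median (R : realType) (s : seq R) (v : R) : Prop :=
  [/\ (2 * count (fun z => (z < v)%R) s <= size s)%N,
      (2 * count (fun z => (v < z)%R) s <= size s)%N
    & (1 < size s)%N -> has (fun z => z < v) s].

Definition linear_time_median (R : realType) (median : seq R -> R * nat) : Prop :=
  exists c : nat, forall s : seq R, uniq s -> s != [::] ->
    is_median s (median s).1 /\ ((median s).2 <= c * size s)%N.

Definition qrap_feasible (R : realType) (n : nat) (l u : 'I_n -> R)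
    (J : seq 'I_n) (S : R) (x : 'I_n -> R) : Prop :=
  \sum_(i <- J) x i = S /\ {in J, forall i, l i <= x i <= u i}.

Definition qrap_objective (R : realType) (n : nat) (a b : 'I_n -> R)
    (J : seq 'I_n) (x : 'I_n -> R) : R :=
  \sum_(i <- J) (2^-1 * a i * x i ^+ 2 + b i * x i).

Definition qrap_optimal (R : realType) (n : nat) (a b l u : 'I_n -> R)
    (J : seq 'I_n) (S : R) (x : 'I_n -> R) : Prop :=
  qrap_feasible l u J S x /\
  forall z, qrap_feasible l u J S z ->
    qrap_objective a b J x <= qrap_objective a b J z.

(* [qrap n a b l u J S] receives the arrays a, b, l, u, the index list J and *)
(* the demand S; its result is relevant on J only, and is unconstrained if   *)
(* the subproblem is infeasible.                                            *)
Definition qrap_solver (R : realType) : Type :=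
  forall n : nat, ('I_n -> R) -> ('I_n -> R) -> ('I_n -> R) -> ('I_n -> R) ->
    seq 'I_n -> R -> ('I_n -> R) * nat.

Definition linear_time_qrap (R : realType) (qrap : qrap_solver R) : Prop :=
  exists c : nat, forall (n : nat) (a b l u : 'I_n -> R) (J : seq 'I_n) (S : R),
    uniq J -> J != [::] -> {in J, forall i, 0 < a i} ->
    ((exists z, qrap_feasible l u J S z) ->
       qrap_optimal a b l u J S (qrap n a b l u J S).1) /\
    ((qrap n a b l u J S).2 <= c * size J)%N.

(* ------------------------------------------------------------------------ *)
(* Breakpoint procedure                                                     *)
(* ------------------------------------------------------------------------ *)

(* The arrays l, u (current bounds), alpha, beta. *)
Record arrays (R : realType) (n : nat) := Arrays {
  lo : 'I_n -> R;
  hi : 'I_n -> R;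
  alpha : 'I_n -> R;
  beta : 'I_n -> R
}.

(* y_j^fixed, A_j, B_j for one block j, or partial sums thereof. *)
Record sums (R : realType) := Sums { Ysum : R; Asum : R; Bsum : R }.

Record bp_state (R : realType) (n : nat) := BpState {
  bpP : seq (R * 'I_n);
  bpQ : seq (R * 'I_n);
  bpS : sums R;
  bpD : arrays R n
}.

Definition alpha_breakpoint (R : realType) (n m : nat) (P : instance R n m)
    (j : 'I_m) (k : 'I_n) (Ps Qs : seq (R * 'I_n)) (s : sums R)
    (d : arrays R n) : prog (bp_state R n) :=
  let: Sums Y A B := s in
  let* v := compute ($(wgt P j) * ($B - $Y)
                     - ($(acoef P k) * $(hi d k) + $(bcoef P k))
                       * ($1 + $(wgt P j) * $A)) in
  let* al := write (alpha d) k v in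
  let* Y' := compute ($Y - $(hi d k)) in
  let* A' := compute ($A + $1 / $(acoef P k)) in
  let* B' := compute ($B + $(bcoef P k) / $(acoef P k)) in
  op (BpState Ps Qs (Sums Y' A' B') (Arrays (lo d) (hi d) al (beta d))).

Definition beta_breakpoint (R : realType) (n m : nat) (P : instance R n m)
    (j : 'I_m) (k : 'I_n) (Ps Qs : seq (R * 'I_n)) (s : sums R)
    (d : arrays R n) : prog (bp_state R n) :=
  let: Sums Y A B := s in
  let* v := compute ($(wgt P j) * ($B - $Y)
                     - ($(acoef P k) * $(lo d k) + $(bcoef P k))
                       * ($1 + $(wgt P j) * $A)) in
  let* be := write (beta d) k v in
  let* Y' := compute ($Y + $(lo d k)) in
  let* A' := compute ($A - $1 / $(acoef P k)) in
  let* B' := compute ($B - $(bcoef P k) / $(acoef P k)) in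
  op (BpState Ps Qs (Sums Y' A' B') (Arrays (lo d) (hi d) (alpha d) be)).

(* On sorted lists the smallest value is at one of the two heads; a value   *)
(* occurring in both lists is treated as an element of Q.                   *)
Definition breakpoint_step (R : realType) (n m : nat) (P : instance R n m)
    (j : 'I_m) (st : bp_state R n) : prog (bp_state R n + arrays R n) :=
  let: BpState Ps Qs s d := st in
  let* _ := tick in
  match Ps, Qs with
  | [::], [::] => ret (inr d)
  | [::], (q, k) :: Qs' =>
      let* st' := alpha_breakpoint P j k Ps Qs' s d in ret (inl st')
  | (p, k) :: Ps', [::] =>
      let* st' := beta_breakpoint P j k Ps' Qs s d in ret (inl st')
  | (p, kp) :: Ps', (q, kq) :: Qs' =>
      let* inQ := op (q <= p) in
      if inQ then
        let* st' := alpha_breakpoint P j kq Ps Qs' s d in ret (inl st')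
      else
        let* st' := beta_breakpoint P j kp Ps' Qs s d in ret (inl st')
  end.

Definition breakpoint_procedure (R : realType) (n m : nat) (P : instance R n m)
    (j : 'I_m) (d : arrays R n) : prog (arrays R n) :=
  let le_key (x y : R * 'I_n) := x.1 <= y.1 in
  let* Ps := foreach (block P j) [::] (fun i s =>
    let* v := compute ($(acoef P i) * $(lo d i) + $(bcoef P i)) in
    op ((v, i) :: s)) in
  let* Qs := foreach (block P j) [::] (fun i s =>
    let* v := compute ($(acoef P i) * $(hi d i) + $(bcoef P i)) in
    op ((v, i) :: s)) in
  let* Ps := merge_sort le_key Ps in
  let* Qs := merge_sort le_key Qs in
  let* Y := foreach (block P j) 0 (fun i Y => compute ($Y + $(hi d i))) in
  let* A := op 0 in
  let* B := op 0 in
  loop (breakpoint_step P j) (BpState Ps Qs (Sums Y A B) d).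

(* ------------------------------------------------------------------------ *)
(* Binary breakpoint search                                                 *)
(* ------------------------------------------------------------------------ *)

(* Tighten the bounds of block j using QRAP^j(L_j) and QRAP^j(U_j), then    *)
(* compute its breakpoints.                                                 *)
Definition prepare_block (R : realType) (qrap : qrap_solver R) (n m : nat)
    (P : instance R n m) (j : 'I_m) (d : arrays R n) : prog (arrays R n) :=
  let solve S := call (qrap n (acoef P) (bcoef P) (lo d) (hi d) (block P j) S) in
  let* xlo := solve (Lbd P j) in
  let* xhi := solve (Ubd P j) in
  let* d' := foreach (block P j) d (fun i d =>
    let* l := compute (Max $(lo d i) $(xlo i)) in
    let* lo' := write (lo d) i l in
    let* u := compute (Min $(hi d i) $(xhi i)) in
    let* hi' := write (hi d) i u in
    ret (Arrays lo' hi' (alpha d) (beta d))) in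
  breakpoint_procedure P j d'.

(* Add to [s] the contributions, at multiplier g, of the indices in J. *)
Definition collect (R : realType) (n m : nat) (P : instance R n m)
    (d : arrays R n) (g : R) (J : seq 'I_n) (s : sums R) : prog (sums R) :=
  foreach J s (fun k s =>
    let: Sums Y A B := s in
    let* lower := op (beta d k <= g) in
    if lower then let* Y' := compute ($Y + $(lo d k)) in ret (Sums Y' A B)
    else
    let* upper := op (g <= alpha d k) in
    if upper then let* Y' := compute ($Y + $(hi d k)) in ret (Sums Y' A B)
    else
    let* A' := compute ($A + $1 / $(acoef P k)) in
    let* B' := compute ($B + $(bcoef P k) / $(acoef P k)) in
    ret (Sums Y A' B')).

Definition collect_all (R : realType) (n m : nat) (P : instance R n m)
    (d : arrays R n) (g : R) (J : 'I_m -> seq 'I_n) (s0 : 'I_m -> sums R) :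
    prog ('I_m -> sums R) :=
  foreach (enum 'I_m) (fun _ => Sums 0 0 0) (fun j s =>
    let* sj := op (s0 j) in
    let* sj' := collect P d g (J j) sj in
    write s j sj').

Definition sum_y (R : realType) (n m : nat) (P : instance R n m)
    (g : R) (s : 'I_m -> sums R) : prog R :=
  foreach (enum 'I_m) 0 (fun j tot =>
    let: Sums Y A B := s j in
    let* y := compute (($Y - $B) / ($1 + $(wgt P j) * $A)
                       - $A / ($1 + $(wgt P j) * $A) * $g) in
    compute ($tot + $y)).

Definition compute_x (R : realType) (n m : nat) (P : instance R n m)
    (d : arrays R n) (g : R) (s : 'I_m -> sums R) : prog ('I_n -> R) :=
  foreach (enum 'I_m) (fun _ => 0) (fun j x =>
    let: Sums Y A B := s j in
    foreach (block P j) x (fun i x =>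
      let* lower := op (beta d i <= g) in
      if lower then write x i (lo d i)
      else
      let* upper := op (g <= alpha d i) in
      if upper then write x i (hi d i)
      else
      let* v := compute ($1 / $(acoef P i)
                           * ((- $(wgt P j) * $Y - $g) / ($1 + $(wgt P j) * $A))
                         - $(bcoef P i) / $(acoef P i)
                         + $(wgt P j) / $(acoef P i)
                           * ($B / ($1 + $(wgt P j) * $A))) in
      write x i v)).

Record state (R : realType) (n m : nat) := State {
  Bset : seq R;
  Iset : 'I_m -> seq 'I_n;
  acc : 'I_m -> sums R;
  down : \bar R;
  up : \bar R
}.

(* Drop from [J] the indices whose status is settled between dn and up,     *)
(* moving their contributions to [s].                                       *)
Definition settle (R : realType) (n m : nat) (P : instance R n m)
    (d : arrays R n) (dn up : \bar R) (J : seq 'I_n) (s : sums R) :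
    prog (seq 'I_n * sums R) :=
  foreach J ([::], s) (fun k st =>
    let: (J', Sums Y A B) := st in
    let* c1 := op ((beta d k)%:E <= dn)%E in
    if c1 then let* Y' := compute ($Y + $(lo d k)) in ret (J', Sums Y' A B)
    else
    let* c2 := op ((alpha d k)%:E <= dn)%E in
    let* c3 := op (dn <= up)%E in
    let* c4 := op (up <= (beta d k)%:E)%E in
    if [&& c2, c3 & c4] then
      let* A' := compute ($A + $1 / $(acoef P k)) in
      let* B' := compute ($B + $(bcoef P k) / $(acoef P k)) in
      ret (J', Sums Y A' B')
    else
    let* c5 := op (up <= (alpha d k)%:E)%E in
    if c5 then let* Y' := compute ($Y + $(hi d k)) in ret (J', Sums Y' A B)
    else
    let* J'' := op (k :: J') in ret (J'', Sums Y A B)).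

Definition settle_all (R : realType) (n m : nat) (P : instance R n m)
    (d : arrays R n) (dn up : \bar R) (J : 'I_m -> seq 'I_n)
    (s : 'I_m -> sums R) : prog (('I_m -> seq 'I_n) * ('I_m -> sums R)) :=
  foreach (enum 'I_m) (fun _ => [::], fun _ => Sums 0 0 0) (fun j st =>
    let* r := settle P d dn up (J j) (s j) in
    let* J' := write st.1 j r.1 in
    let* s' := write st.2 j r.2 in
    ret (J', s')).

Definition select (A : Type) (p : pred A) (s : seq A) : prog (seq A) :=
  foreach s [::] (fun x r =>
    let* c := op (p x) in
    if c then op (x :: r) else ret r).

(* The search has narrowed down the breakpoints to the single value g. *)
Definition finish (R : realType) (n m : nat) (P : instance R n m)
    (d : arrays R n) (g : R) : prog (R * ('I_n -> R)) :=
  let* s := collect_all P d g (block P) (fun _ => Sums 0 0 0) in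
  let* num := foreach (enum 'I_m) 0 (fun j r =>
    let: Sums Y A B := s j in
    compute ($r + ($Y - $B) / ($1 + $(wgt P j) * $A))) in
  let* den := foreach (enum 'I_m) 0 (fun j r =>
    let: Sums Y A B := s j in
    compute ($r + $A / ($1 + $(wgt P j) * $A))) in
  let* lam := compute (($num - $(total P)) / $den) in
  let* s' := collect_all P d lam (block P) (fun _ => Sums 0 0 0) in
  let* x := compute_x P d lam s' in
  ret (lam, x).

Definition search_step (R : realType) (median : seq R -> R * nat) (n m : nat)
    (P : instance R n m) (d : arrays R n) (st : state R n m) :
    prog (state R n m + R * ('I_n -> R)) :=
  let: State Bs J s dn up := st in
  let* many := op (if Bs is [:: _, _ & _] then true else false) in
  if many then
    let* g := call (median Bs) in
    let* sg := collect_all P d g J s in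
    let* tot := sum_y P g sg in
    let* found := op (tot == total P) in
    if found then
      let* x := compute_x P d g sg in ret (inr (g, x))
    else
    let* less := op (tot < total P) in
    if less then
      let* Bs' := select (fun lam => lam < g) Bs in
      let* up' := op g%:E in
      let* Js := settle_all P d dn up' J s in
      op (inl (State Bs' Js.1 Js.2 dn up'))
    else
      let* Bs' := select (fun lam => lam >= g) Bs in
      let* dn' := op g%:E in
      let* Js := settle_all P d dn' up J s in
      op (inl (State Bs' Js.1 Js.2 dn' up))
  else
    let* g := op (head 0 Bs) in
    let* r := finish P d g in
    ret (inr r).

(* The result is the optimal multiplier together with x at that multiplier. *)
Definition binary_algorithm (R : realType) (median : seq R -> R * nat)
    (qrap : qrap_solver R) (n m : nat) (P : instance R n m) :
    prog (R * ('I_n -> R)) :=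
  let* d := foreach (enum 'I_m) (Arrays (lbd P) (ubd P) (fun _ => 0) (fun _ => 0))
              (prepare_block qrap P) in
  let* ab := foreach (enum 'I_n) [::] (fun i s =>
    let* s1 := op (alpha d i :: s) in op (beta d i :: s1)) in
  let* Bs := make_set ab in
  let* Js := foreach (enum 'I_m) (fun _ => [::], fun _ => Sums 0 0 0) (fun j st =>
    let* J := write st.1 j (block P j) in
    let* Y := op 0 in
    let* A := op 0 in
    let* B := op 0 in
    let* s := write st.2 j (Sums Y A B) in
    ret (J, s)) in
  let* dn := op (-oo)%E in
  let* up := op (+oo)%E in
  loop (search_step median P d) (State Bs Js.1 Js.2 dn up).

(* Main.v *)
(** The costs of all subroutines are linear in the sizes of their inputs, except
    for sorting.  Preparing block [j] costs O(n_j log n), hence O(n log n) in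
    total, and sorting the 2n breakpoints costs O(n log n).  A step of the
    search costs O(n), since the sets I_j and B never grow, and the median halves
    [size B - 2] whichever side is kept, so that there are O(log n) steps.
    Nonempty blocks give m <= n. *)

Require Import Defs.
From HB Require Import structures.
From mathcomp Require Import all_boot all_order all_algebra.
From mathcomp Require Import all_classical all_reals all_analysis.
From mathcomp Require Import zify.

Set Implicit Arguments.
Unset Strict Implicit.
Unset Printing Implicit Defensive.

Import Order.TTheory GRing.Theory Num.Theory numFieldNormedType.Exports.

Local Open Scope nat_scope.

(** * A program logic for running times *)

(* Total correctness: [p] terminates, and every run returns a result in [Q]
   within [b] units. *)
Definition spec (A : Type) (p : prog A) (b : nat) (Q : A -> Prop) : Prop :=
  (exists r t, p r t) /\ forall r t, p r t -> Q r /\ t <= b.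

Lemma spec_weaken (A : Type) (p : prog A) (b b' : nat) (Q Q' : A -> Prop) :
  spec p b Q -> b <= b' -> (forall r, Q r -> Q' r) -> spec p b' Q'.
Proof.
move=> [ex bd] leb QQ'; split=> // r t /bd[/QQ' ? ?]; split=> //.
exact: leq_trans leb.
Qed.

Lemma spec_runs_within (A : Type) (p : prog A) (b : nat) (Q : A -> Prop) :
  spec p b Q -> runs_within p b.
Proof. by move=> [ex bd]; split=> // r t /bd[]. Qed.

(** The budget [b] is handed down and diminished rather than split in advance: a proof walks through
    the program, and each instruction leaves one inequality on what remains. *)
Lemma spec_bind (A B : Type) (b1 : nat) (Q1 : A -> Prop) (p : prog A)
    (f : A -> prog B) (b : nat) (Q : B -> Prop) :
  spec p b1 Q1 -> b1 <= b -> (forall a, Q1 a -> spec (f a) (b - b1) Q) ->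
  spec (bind p f) b Q.
Proof.
move=> [[a [t1 pa]] bd1] leb hf; split.
  have [[r [t2 far]] _] := hf a (bd1 _ _ pa).1.
  by exists r, (t1 + t2), a, t1, t2.
move=> r t [a' [t1' [t2' [/bd1[Qa le1] fa ->]]]].
have [_ /(_ _ _ fa)[Qr le2]] := hf a' Qa.
by split=> //; rewrite -(subnKC leb) leq_add.
Qed.

Lemma spec_ret (A : Type) (a : A) (b : nat) (Q : A -> Prop) :
  Q a -> spec (ret a) b Q.
Proof. by move=> Qa; split=> [|r t [-> ->]]; first exists a, 0. Qed.

Lemma spec_op (A : Type) (a : A) (b : nat) (Q : A -> Prop) :
  0 < b -> Q a -> spec (op a) b Q.
Proof. by move=> b0 Qa; split=> [|r t [-> ->]]; first exists a, 1. Qed.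

Lemma spec_op_bind (A B : Type) (a : A) (f : A -> prog B) (b : nat)
    (Q : B -> Prop) :
  0 < b -> spec (f a) (b - 1) Q -> spec (bind (op a) f) b Q.
Proof.
move=> b0 fa; apply: (@spec_bind _ _ 1 (eq a)) => // [|_ <- //].
exact: spec_op.
Qed.

(** The postcondition is asked of every [v]: the cost analysis never looks at the numerical value of
    an expression. *)
Lemma spec_compute (R : realType) (e : expr R) (b : nat) (Q : R -> Prop) :
  operations e < b -> (forall v, Q v) -> spec (compute e) b Q.
Proof.
by move=> eb Qv; split=> [|r t [-> ->]]; first exists (value e), (operations e).+1.
Qed.

Lemma spec_compute_bind (R : realType) (B : Type) (e : expr R) (f : R -> prog B)
    (b : nat) (Q : B -> Prop) :
  operations e < b -> (forall v, spec (f v) (b - (operations e).+1) Q) ->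
  spec (bind (compute e) f) b Q.
Proof.
move=> eb fv; apply: (@spec_bind _ _ (operations e).+1 xpredT) => //.
exact: spec_compute.
Qed.

Lemma spec_call_bind (A B : Type) (c : A * nat) (f : A -> prog B) (b t : nat)
    (Q : B -> Prop) :
  c.2 <= t -> t < b -> spec (f c.1) (b - t.+1) Q -> spec (bind (call c) f) b Q.
Proof.
move=> ct tb fc; apply: (@spec_bind _ _ t.+1 (eq c.1)) => // [|_ <- //].
by split=> [|r u [-> ->]]; first exists c.1, c.2.+1.
Qed.

(* The invariant takes the list of the items still to be processed. *)
Lemma spec_foreach (A S : Type) (Inv : seq A -> S -> Prop) (cost : A -> nat)
    (s : seq A) (st : S) (body : A -> S -> prog S) (b : nat) (Q : S -> Prop) :
  (forall x s' st', Inv (x :: s') st' -> spec (body x st') (cost x) (Inv s')) ->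
  Inv s st -> (forall st', Inv [::] st' -> Q st') ->
  \sum_(x <- s) (cost x).+1 < b -> spec (foreach s st body) b Q.
Proof.
move=> hbody; elim: s st b => [|x s IHs] st b /= hst hQ.
  (* The strict inequality pays for the last test, on the empty list; the successor in each summand
     pays for the others. *)
  rewrite big_nil => b0; apply: spec_op_bind => //.
  exact/spec_ret/hQ.
rewrite big_cons => lb; apply: spec_op_bind; first by lia.
apply: (spec_bind (hbody _ _ _ hst)); first by lia.
move=> st' hst'; apply: IHs => //; lia.
Qed.

Lemma spec_foreach_const (A S : Type) (c : nat) (Inv : S -> Prop)
    (s : seq A) (st : S) (body : A -> S -> prog S) (b : nat) (Q : S -> Prop) :
  (forall x st', Inv st' -> spec (body x st') c Inv) ->
  Inv st -> (forall st', Inv st' -> Q st') ->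
  c.+1 * size s < b -> spec (foreach s st body) b Q.
Proof.
move=> hbody hst hQ lb.
apply: (@spec_foreach _ _ (fun _ => Inv) (fun=> c)) => //.
  by move=> x _; apply: hbody.
by rewrite big_const_seq count_predT iter_addn_0.
Qed.

Lemma loop_inv (S A : Type) (step : S -> prog (S + A)) (s : S) (a : A) (t : nat) :
  loop step s a t -> step s (inr a) t \/
  exists s' t1 t2, [/\ step s (inl s') t1, loop step s' a t2 & t = t1 + t2].
Proof.
by case=> [s0 a0 t0 ?|s0 s' a0 t1 t2 ? ?]; [left | right; exists s', t1, t2].
Qed.

(** The index of [Inv] is a termination measure: it drops by one per continuing step, and at 0 only
    an exit is possible. Hence at most [p.+1] steps, the exiting one included. *)
Lemma spec_loop (S A : Type) (step : S -> prog (S + A)) (Inv : nat -> S -> Prop)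
    (c p : nat) (s : S) (b : nat) (Q : A -> Prop) :
  (forall k s', Inv k s' -> spec (step s') c (fun r =>
     match r with inl s'' => exists2 k', k = k'.+1 & Inv k' s'' | inr a => Q a end)) ->
  Inv p s -> c * p.+1 <= b -> spec (loop step s) b Q.
Proof.
move=> hstep; elim: p s b => [|p IHp] s b hs lb;
  have [[r [t sr]] bd] := hstep _ _ hs.
  split.
    by case: r sr => [s'|a] sr; [have [[]] := bd _ _ sr | exists a, t; left].
  move=> a u hl; have [sa|[s' [t1 [t2 [ss' _ _]]]]] := loop_inv hl.
    by have [] := bd _ _ sa; split=> //; lia.
  by have [[]] := bd _ _ ss'.
have IH s' : (exists2 k', p.+1 = k'.+1 & Inv k' s') -> spec (loop step s') (b - c) Q.
  by move=> [k' [<-] /IHp]; apply; lia.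
split.
  case: r sr => [s'|a] sr; last by exists a, t; left.
  have [[a [t2 la]] _] := IH _ (bd _ _ sr).1.
  by exists a, (t + t2); apply: loop_next la.
move=> a u hl; have [sa|[s' [t1 [t2 [ss' la ->]]]]] := loop_inv hl.
  by have [] := bd _ _ sa; split=> //; lia.
have [hs' le1] := bd _ _ ss'.
have [_ /(_ _ _ la)[Qa le2]] := IH _ hs'.
by split=> //; lia.
Qed.

(** * Merge sort and the formation of sets *)

(** Each element moved costs a test, a comparison and a list cell. Identifying the result with the
    library's [merge] gives access to its sortedness and size lemmas. *)
Lemma spec_merge_lists (A : Type) (le : rel A) (s1 s2 : seq A) (b : nat) :
  3 * (size s1 + size s2) < b ->
  spec (merge_lists le s1 s2) b (eq (merge le s1 s2)).
Proof.
elim: s1 s2 b => [|x1 s1 IH1] s2 b.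
  by move=> lb /=; apply: spec_op_bind; [lia | apply: spec_ret].
elim: s2 b => [|x2 s2 IH2] b /= lb.
  by apply: spec_op_bind; [lia | apply: spec_ret].
apply: spec_op_bind; first by lia.
apply: spec_op_bind; first by lia.
case: ifP => _.
  apply: (spec_bind (b1 := b - 3)); [|by lia|].
    by apply: IH1 => /=; lia.
  by move=> s <-; apply: spec_op => //; lia.
apply: (spec_bind (b1 := b - 3)); [|by lia|].
  by apply: IH2 => /=; lia.
by move=> s <-; apply: spec_op => //; lia.
Qed.

Lemma spec_merge_pairs (A : Type) (le : rel A) (ss : seq (seq A)) (b : nat) :
  total le -> all (sorted le) ss ->
  3 * (size (flatten ss) + size ss) < b ->
  spec (merge_pairs le ss) b (fun rr =>
    [/\ all (sorted le) rr, size (flatten rr) = size (flatten ss)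
      & size rr = uphalf (size ss)]).
Proof.
(* Two lists are consumed per call, so the induction is on a bound for the number of lists. *)
move=> tot; have [k] := ubnP (size ss).
elim: k ss b => // k IHk [|s1 [|s2 ss]] b /= ltk.
- by move=> _ lb; apply: spec_op_bind; [lia | apply: spec_ret].
- by move=> ? lb; apply: spec_op_bind; [lia | apply: spec_ret].
case/and3P=> so1 so2 sos; rewrite !size_cat => lb.
apply: spec_op_bind; first by lia.
apply: spec_bind; [exact: spec_merge_lists | lia |] => s <-.
apply: spec_bind; [apply: IHk; [lia| done | exact: ltnSn] | lia |] => r [sor szr nr].
apply: spec_op; first by lia.
by rewrite /= merge_sorted // sor size_cat size_merge size_cat szr nr; split=> //; lia.
Qed.

(** The exponent [p] plays the part of the logarithm: every pass costs a linear amount and halves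
    the number of lists, which starts at [size s]. *)
Lemma spec_merge_sort (A : Type) (le : rel A) (s : seq A) (p b : nat) :
  total le -> size s <= 2 ^ p -> 20 * (size s).+1 * p.+1 <= b ->
  spec (merge_sort le s) b (fun r => sorted le r /\ size r = size s).
Proof.
move=> tot sp lb.
pose I (rem : seq A) (ss : seq (seq A)) := [/\ all (sorted le) ss,
   size (flatten ss) + size rem = size s & size ss + size rem = size s].
apply: (@spec_bind _ _ (2 * size s).+1 (I [::])); [|nia|].
  apply: (@spec_foreach _ _ I (fun=> 1)) => //.
    move=> x s' st' [so sz n]; apply: spec_op => //.
    by split=> //=; rewrite -?[RHS]sz -?[RHS]n //=; lia.
  by rewrite big_const_seq count_predT iter_addn_0.
move=> ss [so]; rewrite !addn0 => sz n.
apply: (@spec_loop _ _ _ (fun k ss => [/\ all (sorted le) ss,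
  size (flatten ss) = size s, size ss <= size s & size ss <= 2 ^ k])
  (6 * size s + 3) p); [|by split=> //; rewrite n|by nia].
move=> k ss' [so' sz' n' k']; apply: spec_op_bind; first by lia.
case: ss' so' sz' n' k' => [|s1 [|s2 ss']] so' sz' n' k'.
- by apply: spec_ret; rewrite -sz'.
- by apply: spec_ret; move: so' sz'; rewrite /= andbT cats0.
apply: spec_bind; [apply: spec_merge_pairs => //; exact: ltnSn | lia |].
move=> r [sor szr nr]; apply: spec_ret.
(* At [k = 0] at most one list would be left, whereas this branch has two. *)
case: k k' => [|k] k'; first by rewrite expn0 in k'.
exists k => //; rewrite expnS in k'; split=> //; rewrite ?szr ?nr //=.
  by rewrite (leq_trans _ n') //= ; lia.
by move: k' => /=; lia.
Qed.

(** Equal values are adjacent after sorting, so comparison with the last value kept detects all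
    duplicates. The accumulator is strictly decreasing, hence duplicate-free. *)
Lemma spec_make_set (R : realType) (s : seq R) (p b : nat) :
  size s <= 2 ^ p -> 24 * (size s).+1 * p.+1 <= b ->
  spec (make_set s) b (fun r => uniq r /\ size r <= size s).
Proof.
move=> sp lb.
apply: (spec_bind (b1 := 20 * (size s).+1 * p.+1)); [|nia|].
  by apply: (spec_merge_sort (p := p)) => // x y; exact: le_total.
(* [szt] is about a convertible list type, which [lia] does not see through. *)
move=> t [sot szt]; have {}szt : size t = size s := szt.
apply: (@spec_foreach _ _ (fun rem (r : seq R) =>
   [/\ sorted >%R r, size r + size rem <= size s
     & sorted <=%R (if r is y :: _ then y :: rem else rem)]) (fun=> 2)).
- move=> x s' acc [so szr path].
  apply: spec_op_bind => //.
  case: ifP => [|neq]; [move=> eqx; apply: spec_ret|apply: spec_op => //].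
  + case: acc eqx so szr path => //= y acc /eqP -> so szr /andP[_ path].
    by split=> //; lia.
  + case: acc neq so szr path => [|y acc] neq so szr /= path; first by split=> //; lia.
    case/andP: path=> lexy path; split=> //; last by move: szr => /=; lia.
    by move: so => /= ->; rewrite andbT lt_neqAle lexy eq_sym neq.
- by split=> //; rewrite szt.
- move=> r [so szr _]; split; last by rewrite addn0 in szr.
  apply: (@sorted_uniq _ >%R) so => [x y z xy yz|x]; last exact: ltxx.
  exact: lt_trans yz xy.
- rewrite big_const_seq count_predT iter_addn_0 szt.
  by have := leq_pmulr (size s).+1 (ltn0Sn p); lia.
Qed.

(** * The breakpoint procedure and the preparation of a block *)

(** Runs through straight-line code under a numeral budget, where the side conditions hold by
    computation. *)
Ltac charge := repeat first
  [ apply: spec_compute_bind; [by [] | move=> ?]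
  | apply: spec_op_bind; [by [] |] ].

Lemma spec_alpha_breakpoint (R : realType) (n m : nat) (P : instance R n m)
    (j : 'I_m) (k : 'I_n) (Ps Qs : seq (R * 'I_n)) (s : sums R) (d : arrays R n) :
  spec (alpha_breakpoint P j k Ps Qs s d) 20 (fun st => bpP st = Ps /\ bpQ st = Qs).
Proof. by case: s => Y A B; rewrite /alpha_breakpoint; charge; apply: spec_op. Qed.

Lemma spec_beta_breakpoint (R : realType) (n m : nat) (P : instance R n m)
    (j : 'I_m) (k : 'I_n) (Ps Qs : seq (R * 'I_n)) (s : sums R) (d : arrays R n) :
  spec (beta_breakpoint P j k Ps Qs s d) 20 (fun st => bpP st = Ps /\ bpQ st = Qs).
Proof. by case: s => Y A B; rewrite /beta_breakpoint; charge; apply: spec_op. Qed.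

(** The two lists together lose exactly one key per iteration, which is the descent that [spec_loop]
    asks for. *)
Lemma spec_breakpoint_step (R : realType) (n m : nat) (P : instance R n m)
    (j : 'I_m) (st : bp_state R n) :
  spec (breakpoint_step P j st) 24 (fun r => if r is inl st' then
    size (bpP st) + size (bpQ st) = (size (bpP st') + size (bpQ st')).+1 else True).
Proof.
case: st => [[|[p kp] Ps] [|[q kq] Qs] s d]; rewrite /breakpoint_step; charge.
- exact: spec_ret.
- apply: spec_bind; [exact: spec_alpha_breakpoint | by [] |].
  by move=> st' [hP hQ]; apply: spec_ret; rewrite hP hQ /=; lia.
- apply: spec_bind; [exact: spec_beta_breakpoint | by [] |].
  by move=> st' [hP hQ]; apply: spec_ret; rewrite hP hQ /=; lia.
- case: ifP => _.
  + apply: spec_bind; [exact: spec_alpha_breakpoint | by [] |].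
    by move=> st' [hP hQ]; apply: spec_ret; rewrite hP hQ /=; lia.
  + apply: spec_bind; [exact: spec_beta_breakpoint | by [] |].
    by move=> st' [hP hQ]; apply: spec_ret; rewrite hP hQ /=; lia.
Qed.

Lemma spec_breakpoint_procedure (R : realType) (n m : nat) (P : instance R n m)
    (j : 'I_m) (d : arrays R n) (p : nat) :
  size (block P j) <= 2 ^ p ->
  spec (breakpoint_procedure P j d) (110 * (size (block P j)).+1 * p.+1) xpredT.
Proof.
set J := block P j => Jp; rewrite /breakpoint_procedure -/J.
(* Both key lists come from the same loop: per index two operations, a store and a list cell,
   besides the loop test. *)
have keys (v : 'I_n -> expr R) : (forall i, operations (v i) = 2) ->
    spec (foreach J [::] (fun i s => bind (compute (v i)) (fun x => op ((x, i) :: s))))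
      (5 * size J).+1 (fun s : seq (R * 'I_n) => size s = size J).
  move=> v2.
  apply: (@spec_foreach _ _ (fun rem s => size s + size rem = size J) (fun=> 4)) => //.
  - move=> i s' st /= h; apply: spec_compute_bind; first by rewrite v2.
    by move=> x; rewrite v2; apply: spec_op => //=; lia.
  - by move=> st; rewrite addn0.
  - by rewrite big_const_seq count_predT iter_addn_0.
have tot : total (fun x y : R * 'I_n => (x.1 <= y.1)%R) by move=> x y; exact: le_total.
apply: (spec_bind (keys _ _)); [by [] | nia |] => Ps sP.
apply: (spec_bind (keys _ _)); [by [] | nia |] => Qs sQ.
apply: (spec_bind (b1 := 20 * (size J).+1 * p.+1)
                  (Q1 := fun s => size s = size J)); [|nia|] => [|Ps' sP'].
  apply: (spec_weaken (spec_merge_sort (p := p) tot _ (leqnn _))); rewrite ?sP //.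
  by move=> r [].
apply: (spec_bind (b1 := 20 * (size J).+1 * p.+1)
                  (Q1 := fun s => size s = size J)); [|nia|] => [|Qs' sQ'].
  apply: (spec_weaken (spec_merge_sort (p := p) tot _ (leqnn _))); rewrite ?sQ //.
  by move=> r [].
apply: (spec_bind (b1 := (3 * size J).+1) (Q1 := xpredT)); [|nia|] => [|Y _].
  apply: (spec_foreach_const (c := 2) (Inv := xpredT)) => // i Y _.
  exact: spec_compute.
apply: spec_op_bind; first by nia.
apply: spec_op_bind; first by nia.
apply: (@spec_loop _ _ _ (fun k st => size (bpP st) + size (bpQ st) = k)
  24 (2 * size J)).
- move=> k st <-.
  apply: spec_weaken (spec_breakpoint_step P j st) (leqnn _) _ => -[st'|d'] //= h.
  by exists (size (bpP st') + size (bpQ st')).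
- by rewrite /= sP' sQ'; lia.
- by nia.
Qed.

Lemma spec_prepare_block (R : realType) (qrap : qrap_solver R) (n m : nat)
    (P : instance R n m) (j : 'I_m) (d : arrays R n) (c p : nat) :
  (forall l u S, (qrap n (acoef P) (bcoef P) l u (block P j) S).2
     <= c * size (block P j)) ->
  size (block P j) <= 2 ^ p ->
  spec (prepare_block qrap P j d)
    ((2 * c + 130) * (size (block P j)).+1 * p.+1) xpredT.
Proof.
move=> hq Jp; rewrite /prepare_block.
set J := block P j in hq Jp *.
apply: spec_call_bind; [exact: hq | nia |].
apply: spec_call_bind; [exact: hq | nia |].
apply: (spec_bind (b1 := (7 * size J).+1) (Q1 := xpredT)); [|nia|] => [|d' _].
  apply: (spec_foreach_const (c := 6) (Inv := xpredT)) => // i d' _.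
  by charge; apply: spec_ret.
apply: (spec_weaken (spec_breakpoint_procedure d' Jp)) => //.
rewrite -/J; nia.
Qed.

(** * Linear-time passes over the blocks *)

Lemma leq_blocks (R : realType) (n m : nat) (P : instance R n m) :
  (forall j, exists i, blk P i = j) -> m <= n.
Proof.
move=> surj; rewrite -[m]card_ord -[n]card_ord.
have -> : #|'I_m| = #|codom (blk P)|.
  by apply: esym; apply: eq_card => j; have [i <-] := surj j; rewrite codom_f.
exact: leq_image_card.
Qed.

(** The blocks partition the [n] indices, so nested loops over blocks and their indices add up to a
    linear cost instead of [n * m]. *)
Lemma leq_sum_block (R : realType) (n m : nat) (P : instance R n m)
    (J : 'I_m -> seq 'I_n) (c e : nat) :
  (forall j, size (J j) <= size (block P j)) ->
  \sum_(j <- enum 'I_m) (c * size (J j) + e) <= c * n + e * m.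
Proof.
move=> sJ; rewrite big_enum big_split /= sum_nat_const card_ord [m * e]mulnC leq_add2r.
rewrite -big_distrr /= leq_mul2l; apply/orP; right.
apply: leq_trans (leq_sum _ (fun j _ => sJ j)) _.
rewrite -[leqRHS]card_ord -sum1_card (partition_big (blk P) xpredT) //=.
apply: leq_sum => j _.
by rewrite /block -cardE cardsE sum1_card.
Qed.

Lemma spec_collect_all (R : realType) (n m : nat) (P : instance R n m)
    (d : arrays R n) (g : R) (J : 'I_m -> seq 'I_n) (s0 : 'I_m -> sums R) :
  m <= n -> (forall j, size (J j) <= size (block P j)) ->
  spec (collect_all P d g J s0) (14 * n).+1 xpredT.
Proof.
move=> mn sJ.
apply: (@spec_foreach _ _ (fun _ => xpredT) (fun j => 9 * size (J j) + 4)) => //.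
  move=> j _ s _; apply: spec_op_bind; first by lia.
  apply: (spec_bind (b1 := (9 * size (J j)).+1) (Q1 := xpredT)); [|lia|].
    apply: (spec_foreach_const (c := 8) (Inv := xpredT)) => // k [Y A B] _.
    charge; case: ifP => _; first by charge; apply: spec_ret.
    charge; case: ifP => _; by charge; apply: spec_ret.
  by move=> s' _; apply: spec_op => //; lia.
(* The test of the outer loop joins the constant term, giving the affine summand of
   [leq_sum_block]. *)
under eq_bigr do rewrite -addnS.
by apply: leq_ltn_trans (leq_sum_block 9 5 sJ) _; lia.
Qed.

Lemma spec_sum_y (R : realType) (n m : nat) (P : instance R n m)
    (g : R) (s : 'I_m -> sums R) :
  m <= n -> spec (sum_y P g s) (13 * n).+1 xpredT.
Proof.
move=> mn; apply: (spec_foreach_const (c := 12) (Inv := xpredT)) => //.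
  by move=> j tot _; case: (s j) => Y A B; charge; apply: spec_compute.
by rewrite size_enum_ord; lia.
Qed.

Lemma spec_compute_x (R : realType) (n m : nat) (P : instance R n m)
    (d : arrays R n) (g : R) (s : 'I_m -> sums R) :
  m <= n -> spec (compute_x P d g s) (40 * n).+1 xpredT.
Proof.
move=> mn.
apply: (@spec_foreach _ _ (fun _ => xpredT) (fun j => 30 * size (block P j) + 1)) => //.
  move=> j _ x _; case: (s j) => Y A B.
  apply: (spec_foreach_const (c := 29) (Inv := xpredT)) => //; last by lia.
  move=> i {}x _; charge; case: ifP => _; first by charge; apply: spec_op.
  by charge; case: ifP => _; charge; apply: spec_op.
under eq_bigr do rewrite -addnS.
by apply: leq_ltn_trans (leq_sum_block (P := P) 30 2 (fun=> leqnn _)) _; lia.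
Qed.

(** The postcondition re-establishes the bound on the index lists that the next search step starts
    from. *)
Lemma spec_settle_all (R : realType) (n m : nat) (P : instance R n m)
    (d : arrays R n) (dn up : \bar R) (J : 'I_m -> seq 'I_n) (s : 'I_m -> sums R) :
  m <= n -> (forall j, size (J j) <= size (block P j)) ->
  spec (settle_all P d dn up J s) (20 * n).+1
    (fun r => forall j, size (r.1 j) <= size (block P j)).
Proof.
move=> mn sJ.
apply: (@spec_foreach _ _ (fun _ r => forall j, size (r.1 j) <= size (block P j))
  (fun j => 13 * size (J j) + 4)) => //.
  move=> j _ st sst.
  apply: (spec_bind (b1 := (13 * size (J j)).+1)
    (Q1 := fun r => size r.1 <= size (J j))); [|lia|].
    apply: (@spec_foreach _ _ (fun rem r => size r.1 + size rem <= size (J j))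
      (fun=> 12)) => //.
    + move=> k rem [J' [Y A B]] /= le; charge.
      case: ifP => _; first by charge; apply: spec_ret => /=; lia.
      charge; case: ifP => _; first by charge; apply: spec_ret => /=; lia.
      charge; case: ifP => _; first by charge; apply: spec_ret => /=; lia.
      by charge; apply: spec_ret => /=; lia.
    + by move=> r; rewrite addn0.
    + by rewrite big_const_seq count_predT iter_addn_0.
  move=> r sr; apply: spec_op_bind; first by lia.
  apply: spec_op_bind; first by lia.
  apply: spec_ret => i /=; rewrite /upd; case: eqP => // ->.
  exact: leq_trans sr _.
under eq_bigr do rewrite -addnS.
by apply: leq_ltn_trans (leq_sum_block 13 5 sJ) _; lia.
Qed.

(** Consing reverses the order, which is harmless: only the size and [uniq] matter later. *)
Lemma spec_select (A : Type) (p : pred A) (s : seq A) :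
  spec (select p s) (3 * size s).+1 (eq (rev [seq x <- s | p x])).
Proof.
apply: (@spec_foreach _ _
  (fun rem r => rev [seq x <- s | p x] = catrev [seq x <- rem | p x] r) (fun=> 2)) => //.
- move=> x rem r /= ->; apply: spec_op_bind => //.
  by case: ifP => _; [apply: spec_op | apply: spec_ret].
- by rewrite big_const_seq count_predT iter_addn_0.
Qed.

Lemma spec_finish (R : realType) (n m : nat) (P : instance R n m)
    (d : arrays R n) (g : R) :
  m <= n -> spec (finish P d g) (90 * n.+1) xpredT.
Proof.
move=> mn.
apply: spec_bind; [exact: spec_collect_all | lia |] => s _.
apply: (spec_bind (b1 := (7 * m).+1) (Q1 := xpredT)); [|lia|].
  apply: (spec_foreach_const (c := 6) (Inv := xpredT)); rewrite ?size_enum_ord //.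
  by move=> j r _; case: (s j) => Y A B; apply: spec_compute.
move=> num _; apply: (spec_bind (b1 := (6 * m).+1) (Q1 := xpredT)); [|lia|].
  apply: (spec_foreach_const (c := 5) (Inv := xpredT)); rewrite ?size_enum_ord //.
  by move=> j r _; case: (s j) => Y A B; apply: spec_compute.
move=> den _; apply: spec_compute_bind => [/=|lam]; first by lia.
apply: spec_bind; [exact: spec_collect_all | rewrite /=; lia |] => s' _.
apply: spec_bind; [exact: spec_compute_x | rewrite /=; lia |] => x _.
exact: spec_ret.
Qed.

(** * Progress of the median search *)

Lemma median_lower_half (R : realType) (s : seq R) (v : R) :
  is_median s v -> size [seq z <- s | (z < v)%R] <= (size s)./2.
Proof. by move=> [lev _ _]; rewrite size_filter geq_half_double -mul2n. Qed.

Lemma median_lower_proper (R : realType) (s : seq R) (v : R) :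
  1 < size s -> is_median s v -> size [seq z <- s | (z < v)%R] < size s.
Proof.
move=> s1 /median_lower_half lev; apply: leq_ltn_trans lev _.
by rewrite ltn_half_double -addnn; lia.
Qed.

(** The upper side keeps [v] itself, which occurs at most once by [uniq]; hence the extra 1. *)
Lemma median_upper_half (R : realType) (s : seq R) (v : R) :
  uniq s -> is_median s v ->
  size [seq z <- s | (v <= z)%R] <= (size s)./2.+1.
Proof.
move=> us [_ gev _]; rewrite size_filter.
have -> : count (fun z => (v <= z)%R) s =
          count_mem v s + count (fun z => (v < z)%R) s.
  by elim: s {us gev} => //= z s ->; case: ltgtP => _; lia.
by rewrite count_uniq_mem //; case: (v \in s); lia.
Qed.

(** By the last clause of [is_median] some element lies below [v]. For two elements the halving
    bound is 2, so it alone would show no progress. *)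
Lemma median_upper_proper (R : realType) (s : seq R) (v : R) :
  1 < size s -> is_median s v -> size [seq z <- s | (v <= z)%R] < size s.
Proof.
move=> s1 [_ _ /(_ s1)]; rewrite size_filter has_count => hlt.
rewrite -(count_predC (fun z => (v <= z)%R)) -[ltnLHS]addn0 ltn_add2l.
by rewrite (eq_count (a2 := fun z => (z < v)%R)) // => z /=; rewrite ltNge.
Qed.

(* [(2 ^ k)./2.+1] bounds the number of breakpoints when k iterations are left:
   1 for k = 0, 2 for k = 1, then 2 ^ k.-1 + 1. *)
Lemma leq_half_expn (a b k : nat) :
  a <= b./2.+1 -> a < b -> b <= (2 ^ k.+1)./2.+1 -> a <= (2 ^ k)./2.+1.
(* For [k = 0] strictness brings 2 down to 1; otherwise [2 ^ k] is even, and halving [2 ^ k + 1]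
   discards the 1. *)
Proof. by case: k => [|k]; rewrite !expnS ?expn0; lia. Qed.

(** The invariant joins [uniq], required by the median, with linear size bounds that pay for a step
    and a power of 2 that counts the steps left. *)
Lemma spec_search (R : realType) (median : seq R -> R * nat) (n m : nat)
    (P : instance R n m) (d : arrays R n) (c p : nat) (st : state R n m) :
  (forall s : seq R, uniq s -> s != [::] ->
    is_median s (median s).1 /\ (median s).2 <= c * size s) ->
  m <= n -> uniq (Bset st) -> size (Bset st) <= 2 * n ->
  size (Bset st) <= (2 ^ p)./2.+1 ->
  (forall j, size (Iset st j) <= size (block P j)) ->
  spec (loop (search_step median P d) st) ((2 * c + 300) * n.+1 * p.+1) xpredT.
Proof.
move=> hmed mn uB nB pB sI.
apply: (@spec_loop _ _ _ (fun k st => [/\ uniq (Bset st), size (Bset st) <= 2 * n,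
  size (Bset st) <= (2 ^ k)./2.+1 &
  forall j, size (Iset st j) <= size (block P j)]) ((2 * c + 300) * n.+1) p) => //.
move=> k [Bs J s dn up] /= {uB nB pB sI} [uB nB kB sI].
apply: spec_op_bind; first by lia.
case: ifP => [many|_]; last first.
  (* An empty [Bs] also ends up here, with the default 0 of [head]; the cost of [finish] is the same
     for every multiplier. *)
  apply: spec_op_bind; first by lia.
  apply: spec_bind; [exact: spec_finish | nia |] => r _.
  exact: spec_ret.
have B1 : 1 < size Bs by case: (Bs) many => [|? []].
have B0 : Bs != [::] by case: (Bs) B1.
have [med tmed] := hmed Bs uB B0.
(* With no step left the bound is 1, contradicting [B1]. *)
case: k kB => [|k] kB; first by move: kB B1; rewrite expn0 /=; lia.
have {}tmed : (median Bs).2 <= 2 * c * n.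
  by rewrite (leq_trans tmed) // mulnAC [c * _]mulnC leq_mul2r nB orbT.
apply: (spec_call_bind tmed); first by nia.
set g := (median Bs).1 in med *.
apply: spec_bind; [exact: spec_collect_all | lia |] => sg _.
apply: spec_bind; [exact: spec_sum_y | lia |] => tot _.
apply: spec_op_bind; first by lia.
case: ifP => _.
  apply: spec_bind; [exact: spec_compute_x | lia |] => x _.
  exact: spec_ret.
apply: spec_op_bind; first by lia.
case: ifP => _.
- apply: spec_bind; [exact: spec_select | lia |] => _ <-.
  apply: spec_op_bind; first by lia.
  apply: spec_bind; [exact: spec_settle_all | lia |] => Js sJs.
  apply: spec_op; first by lia.
  exists k => //=; rewrite rev_uniq filter_uniq // size_rev; split=> //.
    by rewrite (leq_trans _ nB) // size_filter count_size.
  exact: leq_half_expn (leqW (median_lower_half med)) (median_lower_proper B1 med) kB.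
- apply: spec_bind; [exact: spec_select | lia |] => _ <-.
  apply: spec_op_bind; first by lia.
  apply: spec_bind; [exact: spec_settle_all | lia |] => Js sJs.
  apply: spec_op; first by lia.
  exists k => //=; rewrite rev_uniq filter_uniq // size_rev; split=> //.
    by rewrite (leq_trans _ nB) // size_filter count_size.
  exact: leq_half_expn (median_upper_half uB med) (median_upper_proper B1 med) kB.
Qed.

(** * The complete algorithm *)

(** The factor 4 in [4 * n <= 2 ^ p] comes from the [2 * n] breakpoints and from the search, whose
    initial bound is about half of [2 ^ p]. The same [p] serves to sort every block. *)
Lemma spec_binary_algorithm (R : realType) (median : seq R -> R * nat)
    (qrap : qrap_solver R) (n m : nat) (P : instance R n m) (cm cq p : nat) :
  (forall s : seq R, uniq s -> s != [::] ->
    is_median s (median s).1 /\ (median s).2 <= cm * size s) ->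
  (forall j l u S, (qrap n (acoef P) (bcoef P) l u (block P j) S).2
     <= cq * size (block P j)) ->
  (forall j, exists i, blk P i = j) -> 4 * n <= 2 ^ p ->
  spec (binary_algorithm median qrap P) ((2 * cm + 4 * cq + 1000) * n.+1 * p.+1) xpredT.
Proof.
move=> hmed hq surj np; have mn := leq_blocks surj.
have Jn j : size (block P j) <= n.
  by rewrite /block -cardE (leq_trans (max_card _)) ?card_ord.
apply: (spec_bind (b1 := (4 * cq + 400) * n.+1 * p.+1) (Q1 := xpredT)); [|nia|].
  apply: (@spec_foreach _ _ (fun _ => xpredT)
    (fun j => (2 * cq + 130) * (size (block P j)).+1 * p.+1)) => //.
    by move=> j _ d _; apply: spec_prepare_block => //; have := Jn j; lia.
  rewrite (eq_bigr (fun j => (2 * cq + 130) * p.+1 * size (block P j)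
                             + ((2 * cq + 130) * p.+1).+1)); last by move=> j _; lia.
  apply: leq_ltn_trans (leq_sum_block (P := P) _ _ (fun=> leqnn _)) _.
  have := leq_mul (leqnn ((2 * cq + 130) * p.+1).+1) mn; nia.
move=> d _.
apply: (spec_bind (b1 := (3 * n).+1) (Q1 := fun s => size s = 2 * n)); [|nia|].
  apply: (@spec_foreach _ _ (fun rem s => size s + 2 * size rem = 2 * n) (fun=> 2)) => //.
  - by move=> i rem s /= h; charge; apply: spec_op => //=; lia.
  - by rewrite size_enum_ord.
  - by move=> s; rewrite addn0.
  - by rewrite big_const_seq count_predT iter_addn_0 size_enum_ord.
move=> ab sab.
apply: spec_bind; [apply: (spec_make_set (p := p)); [by rewrite sab; lia | exact: leqnn]
  | rewrite sab; nia |] => Bs [uBs sBs].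
apply: (spec_bind (b1 := (6 * n).+1)
  (Q1 := fun r => forall j, size (r.1 j) <= size (block P j))); [|rewrite sab; nia|].
  apply: (spec_foreach_const (c := 5)
    (Inv := fun r => forall j, size (r.1 j) <= size (block P j))) => //.
    move=> j st sst; charge; apply: spec_ret => i /=.
    by rewrite /upd; case: eqP => // ->.
  by rewrite size_enum_ord; lia.
move=> Js sJs.
apply: spec_op_bind; first by rewrite sab; nia.
apply: spec_op_bind; first by rewrite sab; nia.
apply: (spec_weaken (spec_search (p := p) d hmed mn _ _ _ _)) => //=.
- by rewrite -sab.
- by rewrite (leq_trans sBs) // sab; lia.
- by rewrite sab; nia.
Qed.

(** * Asymptotics *)

Local Open Scope classical_set_scope.
Local Open Scope ring_scope.

(** This is [ln] applied to [2 ^ trunc_log 2 n <= n]. *)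
Lemma ler_trunc_log_ln (R : realType) (n : nat) :
  (0 < n)%N -> (trunc_log 2 n)%:R * ln 2 <= ln (n%:R : R).
Proof.
move=> n0; rewrite mulrC mulr_natr -lnXn // ler_ln ?posrE ?exprn_gt0 ?ltr0n //.
by rewrite -natrX ler_nat trunc_logP.
Qed.

Lemma bigO_nlogn (R : realType) (c : nat) :
  (fun n : nat => (c * n.+1 * (trunc_log 2 n).+1)%:R : R^o) =O_\oo
  (fun n : nat => n%:R * ln (n%:R : R) : R^o).
Proof.
have ln2 : 0 < ln 2 :> R by rewrite ln_gt0 // ltr1n.
(* The two successors cost a factor 2 each and the change of base [ln 2]; the added 1 keeps the
   constant positive when [c = 0]. *)
apply/eqO_exP; exists (4 * c%:R / ln 2 + 1 : R).
  by rewrite ltr_wpDl // divr_ge0 ?mulr_ge0 // ltW.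
near=> n.
(* From 2 on the logarithm is at least 1, so its successor is at most its double. *)
have n2 : (2 <= n)%N by near: n; exists 2.
have n0 : (0 < n)%N by lia.
have L0 : (0 < trunc_log 2 n)%N by rewrite trunc_log_gt0.
have lnn : 0 <= ln (n%:R : R) by rewrite ln_ge0 // ler1n.
rewrite !ger0_norm ?mulr_ge0 //.
apply: (@le_trans _ _ (4 * c * n * trunc_log 2 n)%:R).
  rewrite ler_nat.
  have le_n : (n.+1 <= 2 * n)%N by lia.
  have le_L : ((trunc_log 2 n).+1 <= 2 * trunc_log 2 n)%N by lia.
  by have := leq_mul (leqnn c) (leq_mul le_n le_L); rewrite !mulnA; nia.
apply: (@le_trans _ _ (4 * c%:R / ln 2 * (n%:R * ln n%:R))); last first.
  by rewrite ler_wpM2r ?mulr_ge0 // lerDl.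
rewrite !natrM -!mulrA !ler_wpM2l //.
rewrite mulrCA ler_wpM2l // ler_pdivlMl // mulrC.
exact: ler_trunc_log_ln.
Unshelve. all: by end_near.
Qed.

Theorem theorem2 (R : realType) (median : seq R -> R * nat)
    (qrap : qrap_solver R)
    (hmedian : linear_time_median median)
    (hqrap : linear_time_qrap qrap) :
  exists T : nat -> nat,
    (forall (n m : nat) (P : instance R n m), admissible P ->
       runs_within (binary_algorithm median qrap P) (T n)) /\
    ((fun n : nat => (T n)%:R : R^o) =O_\oo
       (fun n : nat => n%:R * ln (n%:R : R) : R^o)).
Proof.
have [cm hm] := hmedian; have [cq hq] := hqrap.
(* With [p = trunc_log 2 n + 3], [p.+1] is at most four times [(trunc_log 2 n).+1], so the constants
   of [spec_binary_algorithm] are multiplied by 4. *)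
exists (fun n => ((8 * cm + 16 * cq + 4000) * n.+1 * (trunc_log 2 n).+1)%N).
split; last exact: bigO_nlogn.
move=> n m P [surj apos _ _].
have np : (4 * n <= 2 ^ (trunc_log 2 n + 3))%N.
  by have := trunc_log_ltn n (ltnSn 1); rewrite !expnD !expnS expn0; lia.
apply: spec_runs_within.
apply: spec_weaken (spec_binary_algorithm hm _ surj np) _ (fun _ => id).
  (* The time bound of the solver covers infeasible subproblems too, so it applies to all [l], [u]
     and [S]; nonemptiness of the block comes from [surj]. *)
  move=> j l u S; apply: (hq n _ _ _ _ _ S _ _ _).2 => [||i _]; last exact: apos.
    exact: enum_uniq.
  have [i ij] := surj j; apply/eqP => /(congr1 (fun s => i \in s)).
  by rewrite mem_enum inE ij eqxx.
nia.
Qed.
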